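(* Let $k\ge 4$ be an integer and let $G$ be a $k$-critical graph. Suppose that $x_1,x_2,\dots,x_{k-3}$ are distinct vertices of $G$ such that $G[\{x_1,x_2,\dots,x_{k-3}\}]$ is a copy of the complete graph $K_{k-3}$, and that $W\subseteq N(x_1)\cap\dots\cap N(x_{k-3})\cap N(u)$ for some vertex $u\in V(G)\setminus\{x_1,x_2,\dots,x_{k-3}\}$. Then there exist a set $W'\subseteq V(G)$ and a bijection $\varphi:W\to W'$ such that for each $w\in W$, $$N(\varphi(w))\cap W=\{w\}\quad\text{and}\quad N(w)\cap W'=\{\varphi(w)\}.$$ Moreover, if $|W|\ge 3$, then $W$ is an independent set in $G$, and $W'\cap W=\emptyset$.
   Context: All graphs are finite and simple. A graph is $k$-chromatic if it is properly $k$-colorable but not properly $(k-1)$-colorable. A graph $G$ is $k$-critical if $G$ is $k$-chromatic but every proper subgraph of $G$ is $(k-1)$-colorable. $N(v)$ denotes the neighborhood of $v$ in $G$, and $G[S]$ denotes the subgraph of $G$ induced on $S\subseteq V(G)$. *)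

(* Defs.v *)
From mathcomp Require Import all_boot.

Set Implicit Arguments.
Unset Strict Implicit.
Unset Printing Implicit Defensive.

(* A finite simple graph whose vertex set is a finite set of elements of T;
   keeping the vertex set separate from T makes subgraphs of a graph on T
   again graphs on T. *)
Record graph (T : finType) := Graph {
  verts : {set T};
  edge : rel T;
  edge_sym : symmetric edge;
  edge_irr : irreflexive edge;
  edge_verts : forall x y, edge x y -> x \in verts
}.

Section Graphs.
Variable T : finType.
Implicit Types (G H : graph T) (S : {set T}) (k n : nat).

Definition nbhd G (v : T) : {set T} := [set w | edge G v w].

Definition subgraph H G : Prop :=
  verts H \subset verts G /\ (forall x y, edge H x y -> edge G x y).

(* As [edge] is a boolean function, "H differs from G" is expressed
   extensionally: G is not in turn a subgraph of H. *)
Definition proper_subgraph H G : Prop := subgraph H G /\ ~ subgraph G H.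

Definition induced_edge G S : rel T :=
  [rel x y | [&& x \in S, y \in S & edge G x y]].

Fact induced_edge_sym G S : symmetric (induced_edge G S).
Proof. by move=> x y; rewrite /induced_edge /= andbCA edge_sym. Qed.

Fact induced_edge_irr G S : irreflexive (induced_edge G S).
Proof. by move=> x; rewrite /induced_edge /= edge_irr !andbF. Qed.

Fact induced_edge_verts G S x y :
  induced_edge G S x y -> x \in verts G :&: S.
Proof. by case/and3P=> xS _ /edge_verts xG; rewrite inE xG. Qed.

Definition induced G S : graph T :=
  Graph (@induced_edge_sym G S) (@induced_edge_irr G S)
        (@induced_edge_verts G S).

Definition is_complete_graph n G : Prop :=
  #|verts G| = n /\
  {in verts G &, forall x y, x != y -> edge G x y}.

Definition independent G S : Prop := {in S &, forall x y, ~~ edge G x y}.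

(* Colors are the naturals below k; values of c outside [verts G] are
   irrelevant. *)
Definition colorable k G : Prop :=
  exists c : T -> nat,
    {in verts G, forall x, c x < k} /\
    (forall x y, edge G x y -> c x != c y).

Definition chromatic k G : Prop := colorable k G /\ ~ colorable k.-1 G.

Definition critical k G : Prop :=
  chromatic k G /\ (forall H, proper_subgraph H G -> colorable k.-1 H).

End Graphs.

(* Main.v *)
Require Import Defs.
From mathcomp Require Import all_boot.

(** Fix [w] in [W] and delete the edge [uw].  By criticality the resulting
    graph has a [(k-1)]-coloring, and [u] and [w] share a color in it, since
    otherwise it would color [G].  The [k-3] clique vertices have distinct
    colors, all different from the color of [w]; this accounts for [k-2] of the
    [k-1] colors, so exactly one color [b] is left.  Every vertex of [W] other
    than [w] is adjacent to [u] and to the whole clique, hence has color [b].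
    Moreover [w] has a neighbor [p] of color [b], since otherwise recoloring [w]
    with [b] would color [G].  Sharing its color with all of [W] but [w], the
    vertex [p] is adjacent to none of them: take [p] as the image of [w]
    (lemma [private_neighbor]).

    The same coloring shows that [W] minus [w] is independent.  If [W] has at
    least three vertices, any two of them avoid some third vertex [w], so [W]
    itself is independent; an image, being adjacent to a vertex of [W], is then
    outside [W]. *)

Set Implicit Arguments.
Unset Strict Implicit.
Unset Printing Implicit Defensive.

Lemma unique_missing_color n (s : seq nat) :
    uniq s -> size s = n -> {in s, forall d, d < n.+1} ->
  exists b, [/\ b < n.+1, b \notin s
              & forall d, d < n.+1 -> d \notin s -> d = b].
Proof.
move=> s_uniq s_size s_lt.
have /allPn[b] : ~~ all (mem s) (iota 0 n.+1).
  apply/negP=> /allP/(uniq_leq_size (iota_uniq _ _)).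
  by rewrite size_iota s_size ltnn.
rewrite mem_iota /= => b_lt bNs; exists b; split=> // d d_lt dNs.
apply/eqP; apply: contraT => d_neq_b.
have: size [:: d, b & s] <= size (iota 0 n.+1).
  apply: uniq_leq_size => [|e]; first by rewrite /= inE negb_or d_neq_b dNs bNs.
  by rewrite mem_iota !inE => /or3P[/eqP-> | /eqP-> | /s_lt].
by rewrite size_iota /= s_size ltnn.
Qed.

Section EdgeDeletion.
Variables (T : finType) (G : graph T).

Definition same_edge (a b y z : T) : bool :=
  (y == a) && (z == b) || (y == b) && (z == a).

Definition delete_edge_rel (a b : T) : rel T :=
  fun y z => edge G y z && ~~ same_edge a b y z.

Fact delete_edge_sym a b : symmetric (delete_edge_rel a b).
Proof.
move=> y z; rewrite /delete_edge_rel /same_edge edge_sym.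
by rewrite orbC [(y == a) && _]andbC [(y == b) && _]andbC.
Qed.

Fact delete_edge_irr a b : irreflexive (delete_edge_rel a b).
Proof. by move=> y; rewrite /delete_edge_rel edge_irr. Qed.

Fact delete_edge_verts a b y z : delete_edge_rel a b y z -> y \in verts G.
Proof. by case/andP=> /edge_verts. Qed.

Definition delete_edge a b : graph T :=
  Graph (@delete_edge_sym a b) (@delete_edge_irr a b) (@delete_edge_verts a b).

Lemma delete_edge_proper a b : edge G a b -> proper_subgraph (delete_edge a b) G.
Proof.
move=> Eab; split; first by split=> // y z /andP[].
by case=> _ /(_ a b Eab); rewrite /= /delete_edge_rel /same_edge !eqxx andbF.
Qed.

(** Coloring [G] with one edge [ab] missing: the endpoints get the same color,
    because a [(k-1)]-coloring of all of [G] does not exist. *)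
Lemma critical_edge_coloring k a b : critical k G -> edge G a b ->
  exists c : T -> nat,
    [/\ {in verts G, forall y, c y < k.-1}, c a = c b
      & forall y z, edge G y z -> c y = c z -> same_edge a b y z].
Proof.
move=> [[_ Gk] crit] Eab; have [c [c_lt c_ok]] := crit _ (delete_edge_proper Eab).
have c_mono y z : edge G y z -> c y = c z -> same_edge a b y z.
  move=> Eyz cyz; apply: contraT => yzN.
  by have := c_ok y z; rewrite /= /delete_edge_rel Eyz yzN cyz eqxx => /(_ isT).
exists c; split=> //; apply/eqP/negPn/negP=> c_ab; apply: Gk.
exists c; split=> // y z Eyz; apply/eqP=> cyz.
have := c_mono _ _ Eyz cyz.
by case/orP=> /andP[/eqP ya /eqP zb]; move: c_ab; rewrite -ya -zb cyz eqxx.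
Qed.

(** If the color [d] were absent around the endpoint [b], recoloring [b] with
    [d] would repair the one bad edge [ab] and color the whole graph. *)
Lemma critical_edge_neighbor_color k a b (c : T -> nat) d :
    critical k G -> {in verts G, forall y, c y < k.-1} ->
    (forall y z, edge G y z -> c y = c z -> same_edge a b y z) ->
    d < k.-1 ->
  exists2 p, edge G b p & c p = d.
Proof.
move=> [[_ Gk] _] c_lt c_mono d_lt.
have [/existsP[p /andP[Ebp /eqP cp]] | /existsPn noP] :=
  boolP [exists p, edge G b p && (c p == d)]; first by exists p.
case: Gk; exists (fun y => if y == b then d else c y); split=> [y yG | y z Eyz].
  by case: ifP => // _; apply: c_lt.
have off_b v : edge G b v -> d != c v.
  by move=> Ebv; have := noP v; rewrite Ebv eq_sym.
case: (eqVneq y b) => [yb | y_neq]; case: (eqVneq z b) => [zb | z_neq].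
- by move: Eyz; rewrite yb zb edge_irr.
- by apply: off_b; rewrite -yb.
- by rewrite eq_sym; apply: off_b; rewrite -zb edge_sym.
apply/eqP=> /(c_mono _ _ Eyz).
by rewrite /same_edge (negPf y_neq) (negPf z_neq) andbF.
Qed.

End EdgeDeletion.

(** The coloring argument for a single vertex [w], applied to [G] without the
    edge [uw]. *)
Lemma private_neighbor (k : nat) (T : finType) (G : graph T)
    (x : 'I_(k - 3) -> T) (W : {set T}) (u w : T) :
    4 <= k -> critical k G -> (forall i, x i \in verts G) ->
    (forall i j, i != j -> edge G (x i) (x j)) -> (forall i, x i != u) ->
    (forall v i, v \in W -> edge G (x i) v) ->
    {in W, forall v, edge G u v} -> w \in W ->
  exists p, [/\ edge G w p, {in W, forall v, edge G p v -> v = w}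
              & {in W :\ w &, forall v t, ~~ edge G v t}].
Proof.
move=> hk critG xG xK xu xW uW wW.
have [c [c_lt c_uw c_mono]] := critical_edge_coloring critG (uW w wW).
have WG v : v \in W -> v \in verts G.
  by move=> /uW; rewrite edge_sym => /edge_verts.
have xNw i : x i != w.
  by apply/eqP=> xw; have := xW w i wW; rewrite xw edge_irr.
have x_off v i : edge G (x i) v -> c (x i) != c v.
  move=> Exv; apply/eqP=> /(c_mono _ _ Exv).
  by rewrite /same_edge (negPf (xu i)) (negPf (xNw i)).
(* The k-2 colors that a vertex of W other than w cannot have. *)
pose s := c w :: [seq c (x i) | i <- enum 'I_(k - 3)].
have s_uniq : uniq s.
  rewrite /s /= map_inj_uniq ?enum_uniq ?andbT; last first.
    by move=> i j cij; apply: contraTeq isT => /xK/x_off; rewrite cij eqxx.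
  by apply/mapP=> -[i _ cwi]; have := x_off w i (xW w i wW); rewrite cwi eqxx.
have k1E : k.-1 = (k - 2).+1 by rewrite -subSn ?subSS ?subn1 // ltnW // ltnW.
have s_size : size s = k - 2.
  by rewrite /s /= size_map size_enum_ord -subSn ?subSS // ltnW.
have s_lt : {in s, forall d, d < (k - 2).+1}.
  move=> d; rewrite -k1E inE => /orP[/eqP-> | /mapP[i _ ->]]; apply: c_lt => //.
  exact: WG.
have [b [b_lt bNs b_uniq]] := unique_missing_color s_uniq s_size s_lt.
(* Neither end of the deleted edge is in W minus w. *)
have off_uw v t : v \in W -> v != w -> edge G t v -> c t != c v.
  move=> vW v_neq Etv; apply/eqP=> /(c_mono _ _ Etv).
  have v_neq_u : v != u by apply: contraTneq (uW v vW) => ->; rewrite edge_irr.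
  by rewrite /same_edge (negPf v_neq) (negPf v_neq_u) !andbF.
have cW v : v \in W -> v != w -> c v = b.
  move=> vW v_neq; apply: b_uniq; first by rewrite -k1E c_lt ?WG.
  rewrite inE negb_or -c_uw eq_sym off_uw ?uW //=.
  by apply/mapP=> -[i _ cvi]; have := x_off v i (xW v i vW); rewrite cvi eqxx.
rewrite -k1E in b_lt.
have [p Ewp cp] := critical_edge_neighbor_color critG c_lt c_mono b_lt.
exists p; split=> // [v vW Epv | v t /setD1P[v_neq vW] /setD1P[t_neq tW]].
  apply/eqP; apply: contraT => v_neq.
  by have := off_uw v p vW v_neq Epv; rewrite cp cW ?eqxx.
by apply/negP=> /(off_uw t v tW t_neq); rewrite !cW ?eqxx.
Qed.

Theorem lemma2p1 (k : nat) (hk : 4 <= k) (T : finType) (G : graph T)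
  (hG : critical k G)
  (x : 'I_(k - 3) -> T) (hxV : forall i, x i \in verts G)
  (hxinj : injective x)
  (hxK : is_complete_graph (k - 3) (induced G [set x i | i : 'I_(k - 3)]))
  (W : {set T}) (u : T)
  (hu : u \in verts G :\: [set x i | i : 'I_(k - 3)])
  (hW : W \subset (\bigcap_(i < k - 3) nbhd G (x i)) :&: nbhd G u) :
  exists (W' : {set T}) (phi : T -> T),
    [/\ W' \subset verts G,
        {in W &, injective phi} /\ phi @: W = W',
        (forall w, w \in W ->
           nbhd G (phi w) :&: W = [set w] /\ nbhd G w :&: W' = [set phi w])
      & 3 <= #|W| -> independent G W /\ W' :&: W = set0].
Proof.
have {}hW w : w \in W -> (forall i, edge G (x i) w) /\ edge G u w.
  move=> /(subsetP hW) /setIP[/bigcapP xw]; rewrite inE => uw.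
  by split=> // i; have := xw i isT; rewrite inE.
have xS i : x i \in [set x i | i : 'I_(k - 3)] by apply: imset_f.
have xK i j : i != j -> edge G (x i) (x j).
  move=> ij; have [_ /(_ (x i) (x j))] := hxK.
  rewrite !inE !hxV !xS (inj_eq hxinj) => /(_ isT isT ij).
  by case/and3P.
have xu i : x i != u.
  by apply: contraTneq hu => <-; rewrite inE xS.
have priv w := private_neighbor hk hG hxV xK xu
  (fun v i vW => (hW v vW).1 i) (fun v vW => (hW v vW).2) (w := w).
have /fin_all_exists[phi phiP] w : exists p, w \in W ->
    [/\ edge G w p, {in W, forall v, edge G p v -> v = w}
      & {in W :\ w &, forall v t, ~~ edge G v t}].
  by case: (boolP (w \in W)) => [/priv[p pP] | _]; [exists p | exists w].
have phiN w v : w \in W -> v \in W -> edge G (phi w) v = (v == w).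
  move=> wW vW; have [Ewp pW _] := phiP w wW.
  by apply/idP/eqP=> [/(pW v vW) // | ->]; rewrite edge_sym.
exists (phi @: W), phi; split.
- apply/subsetP=> _ /imsetP[w wW ->]; have [Ewp _ _] := phiP w wW.
  by apply: (@edge_verts _ G _ w); rewrite edge_sym.
- split=> // w v wW vW phi_wv; apply/eqP.
  by rewrite -(phiN v w) // -phi_wv phiN.
- move=> w wW; split; apply/setP=> v; rewrite !inE.
    case vW: (v \in W); first by rewrite andbT phiN.
    by rewrite andbF; apply/esym/negP=> /eqP vw; rewrite vw wW in vW.
  apply/andP/eqP=> [[Ewv /imsetP[t tW vt]] | ->].
    by move: Ewv; rewrite vt edge_sym phiN // => /eqP->.
  by rewrite imset_f // edge_sym phiN.
move=> W3.
have W_ind : independent G W.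
  move=> v t vW tW.
  (* Some w in W differs from v and t; then v and t lie in W minus w. *)
  have /card_gt0P[w /setDP[wW]] : 0 < #|W :\: [set v; t]|.
    rewrite cardsD subn_gt0; apply: leq_trans W3; rewrite ltnS.
    by apply: leq_trans (subset_leq_card (subsetIr _ _)) _; rewrite cards2; case: eqP.
  rewrite !inE negb_or => /andP[wv wt]; have [_ _ ind] := phiP w wW.
  by apply: ind; rewrite !inE eq_sym ?wv ?wt.
split=> //; apply/setP=> p; rewrite !inE; apply/andP=> -[/imsetP[w wW ->] pW].
by have [Ewp _ _] := phiP w wW; have := W_ind w (phi w) wW pW; rewrite Ewp.
Qed.
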